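(* Let $\mathcal{F}$ be an atomic system of subsets of $[n]=\{1,\ldots,n\}$ (that is, $\emptyset\in\mathcal{F}$ and $\{a\}\in\mathcal{F}$ for every $a\in[n]$), such that for any two disjoint members $A,B\in\mathcal{F}$, either there exists $a\in A$ such that $B\cup\{a\}\in\mathcal{F}$, or there exists $b\in B$ such that $A\cup\{b\}\in\mathcal{F}$. Then (i) $|\mathcal{F}|\ge e^{(2e^{-1/\sqrt{2}}+o(1))\sqrt{n}}\ge 2^{(1.42+o(1))\sqrt{n}}$; (ii) $\mathrm{rk}(\mathcal{F})\ge \lfloor\sqrt{2n}\rceil$, and this bound is best possible. Consequently, $f(n)\ge 2^{(1.42+o(1))\sqrt{n}}$, where $f(n)$ denotes the minimum cardinality of a system $\mathcal{F}$ of subsets of $[n]$ that is atomic, downward closed (if $A\in\mathcal{F}$ then every subset of $A$ is in $\mathcal{F}$), and such that for any two disjoint members $A,B\in\mathcal{F}$ there exist $a\in A$ and $b\in B$ such that either $B\cup\{a\}\in\mathcal{F}$ and $(A\cup\{b\})\setminus\{a\}\in\mathcal{F}$, or $A\cup\{b\}\in\mathcal{F}$ and $(B\cup\{a\})\setminus\{b\}\in\mathcal{F}$.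
   Context: The rank $\mathrm{rk}(\mathcal{F})$ of a set-system $\mathcal{F}$ is the size of the largest set in $\mathcal{F}$. $\lfloor x\rceil$ denotes the integer closest to $x$. All logarithms are base 2.
   Formalization: Both exchange conditions are required only for nonempty disjoint members A, B: taken literally they fail for A = B = ∅ (and the second for A = ∅ with any B), so no atomic system would satisfy them and f(n) would be undefined. *)

(* Defs.v *)
From mathcomp Require Import all_boot all_order all_algebra.
From mathcomp Require Import lra.

Set Implicit Arguments.
Unset Strict Implicit.
Unset Printing Implicit Defensive.

Import Order.TTheory GRing.Theory Num.Theory.

Section SetSystems.
Variable n : nat.
Implicit Type F : {set {set 'I_n}}.

Definition atomic F : bool := (set0 \in F) && [forall a, [set a] \in F].

Definition downward_closed F : bool :=
  [forall A in F, forall B : {set 'I_n}, (B \subset A) ==> (B \in F)].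

(* The empty set is disjoint from itself and offers no element to exchange,
   so both exchange conditions below concern nonempty members only.  In
   [weak_exchange] this excludes, for an atomic system, just the pair
   A = B = set0; the condition holds automatically when one of them is empty. *)
Definition weak_exchange F : bool :=
  [forall A in F, forall B in F,
    [&& A != set0, B != set0 & [disjoint A & B]] ==>
      [exists a in A, a |: B \in F] || [exists b in B, b |: A \in F]].

Definition strong_exchange F : bool :=
  [forall A in F, forall B in F,
    [&& A != set0, B != set0 & [disjoint A & B]] ==>
      [exists a in A, exists b in B,
        (a |: B \in F) && ((b |: A) :\ a \in F)
        || (b |: A \in F) && ((a |: B) :\ b \in F)]].

Definition rk F : nat := \max_(A in F) #|A|.

Definition admissible F : bool :=
  [&& atomic F, downward_closed F & strong_exchange F].

Lemma admissibleT : admissible [set: {set 'I_n}].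
Proof.
apply/and3P; split.
- by rewrite /atomic inE; apply/forallP => a; rewrite inE.
- by apply/forall_inP => A _; apply/forallP => B; rewrite inE implybT.
- apply/forall_inP => A _; apply/forall_inP => B _; apply/implyP.
  case/and3P => /set0Pn[a aA] /set0Pn[b bB] _.
  apply/exists_inP; exists a => //; apply/exists_inP; exists b => //.
  by rewrite !inE.
Qed.

End SetSystems.

(* The seed [set: {set 'I_n}] of the minimization is admissible, so this is the
   minimum cardinality of an admissible system; see [fP]. *)
Definition f (n : nat) : nat :=
  #|[arg min_(F < [set: {set 'I_n}] | admissible F) #|F|]|.

Lemma fP n :
  (exists2 F : {set {set 'I_n}}, admissible F & #|F| = f n) /\
  (forall F : {set {set 'I_n}}, admissible F -> f n <= #|F|).
Proof.
rewrite /f; case: arg_minnP; first exact: admissibleT.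
by move=> F admF minF; split; [exists F | exact: minF].
Qed.

Local Open Scope ring_scope.

(* Ties are rounded up; they do not occur for x = Num.sqrt (2 * n)%:R. *)
Definition nearest (R : archiRealFieldType) (x : R) : int :=
  Num.floor (x + 2^-1).

Lemma nearestP (R : archiRealFieldType) (x : R) (m : int) :
  `|x - (nearest x)%:~R| <= `|x - m%:~R|.
Proof.
have := floor_itv (x + 2^-1); rewrite -/(nearest x) intrD => /andP[k_le k_gt].
set k := nearest x in k_le k_gt *.
have [m_lt|m_gt|->] := ltgtP m k; last by [].
- have : (m + 1)%:~R <= k%:~R :> R by rewrite ler_int lezD1.
  rewrite intrD => mk; rewrite [leRHS]ger0_norm; last by lra.
  by rewrite ler_norml; apply/andP; split; lra.
- have : (k + 1)%:~R <= m%:~R :> R by rewrite ler_int lezD1.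
  rewrite intrD => km; rewrite [leRHS]ler0_norm; last by lra.
  by rewrite ler_norml; apply/andP; split; lra.
Qed.

(* Main.v *)
Require Import Defs.
From mathcomp Require Import all_boot all_order all_algebra.
From mathcomp Require Import ring lra zify.

Set Implicit Arguments.
Unset Strict Implicit.
Unset Printing Implicit Defensive.

(* Two disjoint members of size k exchange to a member of size k+1 inside their
   union.  Since the exchange property passes to the members contained in a
   subset, removing a member of size k from a set of C(k+1,2)+1 points leaves
   enough points for a second one; hence, by induction on k, every set of
   C(k,2)+1 points contains a member of size k.  Applied to the whole ground
   set this is the rank bound.  Applied to all sets of m = C(k,2)+1 points,
   double counting gives |F| >= (n/m)^k, and k ~ sqrt(2n)/e yields
   |F| >= e^((2 sqrt 2/e + o(1)) sqrt n), where sqrt 2/e >= e^(-1/sqrt 2) is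
   just e^x >= 1 + x at x = 1/sqrt 2 - 1.

   Extremal systems are built recursively: from a system F of rank r on C(r+1,2)
   points and a block P of r+1 new points, pass to F, together with the sets
   C + x for C in F and x in P, and all the subsets of P. *)

(** * The exchange property over an arbitrary finite type *)

Definition extensible (T : finType) (F : {set {set T}}) (A B : {set T}) :=
  (exists2 a, a \in A & a |: B \in F) \/ (exists2 b, b \in B & b |: A \in F).

Lemma extensible_sym (T : finType) (F : {set {set T}}) A B :
  extensible F A B -> extensible F B A.
Proof. by case; [right | left]. Qed.

Definition exchange (T : finType) (F : {set {set T}}) :=
  forall A B, A \in F -> B \in F -> A != set0 -> B != set0 ->
  [disjoint A & B] -> extensible F A B.

Lemma weak_exchangeP n (F : {set {set 'I_n}}) :
  reflect (exchange F) (weak_exchange F).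
Proof.
apply: (iffP forall_inP) => [exF A B AF BF A0 B0 dAB | exF A AF].
  have /forall_inP/(_ B BF) := exF A AF; rewrite A0 B0 dAB /=.
  by case/orP => /exists_inP; [left | right].
apply/forall_inP => B BF; apply/implyP => /and3P[A0 B0 dAB].
by have [|] := exF A B AF BF A0 B0 dAB; move=> /exists_inP ->; rewrite ?orbT.
Qed.

Lemma strong_weak_exchange n (F : {set {set 'I_n}}) :
  strong_exchange F -> weak_exchange F.
Proof.
move/forall_inP => exF; apply/weak_exchangeP => A B AF BF A0 B0 dAB.
have /forall_inP/(_ B BF) := exF A AF; rewrite A0 B0 dAB /=.
case/exists_inP => a aA /exists_inP[b bB] /orP[] /andP[H _].
  by left; exists a.
by right; exists b.
Qed.

(** * Members of prescribed size and the rank bound *)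

Lemma member_of_size (T : finType) (F : {set {set T}}) k (X : {set T}) :
  (forall a, [set a] \in F) -> exchange F -> 'C(k.+1, 2) < #|X| ->
  exists A : {set T}, [/\ A \in F, A \subset X & #|A| = k.+1].
Proof.
move=> F1 exF; elim: k X => [|k IHk] X.
  case/card_gt0P => a aX; exists [set a].
  by rewrite F1 sub1set cards1.
rewrite binS bin1 => ltX.
have [|A [AF sAX cA]] := IHk X; first by apply: leq_ltn_trans ltX; rewrite leq_addr.
have [|B [BF sBX cB]] := IHk (X :\: A).
  by rewrite cardsD (setIidPr sAX) cA ltn_subRL addnC.
have dBA : [disjoint B & A].
  by move: sBX; rewrite subsetD => /andP[].
have sBX' : B \subset X by apply: subset_trans sBX (subsetDl _ _).
have A0 : A != set0 by rewrite -card_gt0 cA.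
have B0 : B != set0 by rewrite -card_gt0 cB.
have [[b bB bA]|[a aA aB]] := exF _ _ BF AF B0 A0 dBA.
  exists (b |: A); split => //.
    by rewrite subUset sub1set (subsetP sBX').
  by rewrite cardsU1 cA (disjointFr dBA bB).
exists (a |: B); split => //.
  by rewrite subUset sub1set (subsetP sAX).
by rewrite cardsU1 cB (disjointFl dBA aA).
Qed.

(** The guard [0 < r] admits [r = 0] on the empty ground set, where ['C(0, 2) < 0] fails but the
    bound is trivial. *)
Lemma leq_rk n (F : {set {set 'I_n}}) r :
  atomic F -> exchange F -> (0 < r -> 'C(r, 2) < n) -> r <= rk F.
Proof.
case: r => // r /andP[_ /forallP F1] exF /(_ isT) ltn.
have [|A [AF _ <-]] := @member_of_size _ F r [set: 'I_n] F1 exF.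
  by rewrite cardsT card_ord.
exact: leq_bigmax_cond.
Qed.

(** * Extremal systems of small rank *)

(** Keeping all members inside a subset [S] of a fixed type lets the induction on [r] remove a block
    from [S] without changing the type. *)
Lemma low_rank_system (T : finType) r (S : {set T}) : #|S| <= 'C(r.+1, 2) ->
  exists F : {set {set T}},
    [/\ set0 \in F, forall a, a \in S -> [set a] \in F, exchange F
      & forall A, A \in F -> A \subset S /\ #|A| <= r].
Proof.
elim: r S => [|r IHr] S.
  rewrite leqn0 cards_eq0 => /eqP ->; exists [set set0]; split.
  - by rewrite inE.
  - by move=> a; rewrite inE.
  - by move=> A B; rewrite inE => /eqP -> _; rewrite eqxx.
  - by move=> A; rewrite inE => /eqP ->; rewrite cards0.
rewrite binS bin1 => leS.
(* When [S] has fewer than [r.+1] points, the block is all of [S] and the recursive call works on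
   the empty set. *)
pose P := [set x in take r.+1 (enum S)].
have cP : #|P| = minn r.+1 #|S|.
  by rewrite cardsE (card_uniqP _) ?take_uniq ?enum_uniq // size_take_min -cardE.
have sPS : P \subset S.
  by apply/subsetP => x; rewrite inE => /mem_take; rewrite mem_enum.
have [|F [F0 F1 exF leF]] := IHr (S :\: P).
  rewrite cardsD (setIidPr sPS) cP; case: (leqP r.+1 #|S|) => _.
    by rewrite leq_subLR addnC.
  by rewrite subnn.
have FP x C : x \in P -> C \in F -> x \notin C.
  move=> xP /leF[]; rewrite subsetD => /andP[_ dCP] _.
  by rewrite (disjointFl dCP xP).
exists (F :|: [set x |: C | x in P, C in F] :|: powerset P).
set F' := _ :|: _.
have subF A : A \in F -> A \in F' by move=> AF; rewrite !inE AF.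
have F'U x A : x \in P -> A \in F -> x |: A \in F'.
  by move=> xP AF; rewrite !inE (imset2_f _ xP AF) orbT.
have F'P (A : {set T}) : A \subset P -> A \in F' by move=> sAP; rewrite !inE sAP !orbT.
split.
- exact: subF.
- move=> a aS; have [aP|aP] := boolP (a \in P); first by apply: F'P; rewrite sub1set.
  by apply/subF/F1; rewrite inE aP.
(* If [B] is not in [F], it contains a point [x] of [P], and [x |: A] belongs to [F'] by
   construction. *)
- have exF'l A B : A \in F -> B \in F' -> A != set0 -> B != set0 ->
      [disjoint A & B] -> extensible F' A B.
    move=> AF; rewrite !inE => /orP[/orP[BF|/imset2P[x C xP CF ->]]|sBP] A0 B0 dAB.
    + have [[a aA aB]|[b bB bA]] := exF _ _ AF BF A0 B0 dAB.
        by left; exists a; rewrite ?subF.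
      by right; exists b; rewrite ?subF.
    + by right; exists x; rewrite ?setU11 ?F'U.
    + have [x xB] := set0Pn _ B0; right; exists x => //.
      by rewrite F'U ?(subsetP sBP).
  (* If [B] is not in [F], it again contains a point of [P], and adding this point to [A] stays
     within [P]. *)
  have exPl (A B : {set T}) : A \subset P -> B \in F' -> A != set0 -> B != set0 ->
      [disjoint A & B] -> extensible F' A B.
    move=> sAP; rewrite !inE => /orP[/orP[BF|/imset2P[x C xP CF ->]]|sBP] A0 B0 dAB.
    + by apply/extensible_sym/exF'l => //; [exact: F'P | rewrite disjoint_sym].
    + by right; exists x; rewrite ?setU11 // F'P // subUset sub1set xP.
    + have [x xB] := set0Pn _ B0; right; exists x => //.
      by rewrite F'P // subUset sub1set (subsetP sBP).
  move=> A B AF' BF' A0 B0 dAB.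
  have dBA : [disjoint B & A] by rewrite disjoint_sym.
  move: (AF'); rewrite !inE => /orP[/orP[AF|/imset2P[x C xP CF defA]]|sAP].
  + exact: exF'l.
  + move: (BF'); rewrite !inE => /orP[/orP[BF|/imset2P[y D yP DF defB]]|sBP].
    * exact/extensible_sym/exF'l.
    (* The exchange in [F] between [C] and [D] lifts by carrying along the block points [x] and [y].
       It needs both to be nonempty; otherwise [A] or [B] is a singleton inside [P]. *)
    * have [C0|C0] := eqVneq C set0.
        by apply: exPl => //; rewrite defA C0 setU0 sub1set.
      have [D0|D0] := eqVneq D set0.
        by apply/extensible_sym/exPl => //; rewrite defB D0 setU0 sub1set.
      have dCD : [disjoint C & D].
        by apply: disjointWl (disjointWr _ dAB); rewrite ?defA ?defB subsetUr.
      have [[c cC cD]|[e eD eC]] := exF _ _ CF DF C0 D0 dCD.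
        left; exists c; first by rewrite defA inE cC orbT.
        by rewrite defB setUCA F'U.
      right; exists e; first by rewrite defB inE eD orbT.
      by rewrite defA setUCA F'U.
    * exact/extensible_sym/exPl.
  + exact: exPl.
- move=> A; rewrite !inE => /orP[/orP[/leF[sAS cA]|/imset2P[x C xP CF ->]]|sAP].
  + by split; [exact: subset_trans sAS (subsetDl _ _) | exact: leqW].
  + have [sCS cC] := leF C CF; split; last by rewrite cardsU1 FP.
    by rewrite subUset sub1set (subsetP sPS) // (subset_trans sCS (subsetDl _ _)).
  + by split; [exact: subset_trans sPS | rewrite (leq_trans (subset_leq_card sAP)) // cP geq_minl].
Qed.

(** * Double counting *)

Lemma card_supersets (T : finType) (A : {set T}) m :
  #|[set X : {set T} | A \subset X & #|X| == m]| <= 'C(#|T| - #|A|, m - #|A|).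
Proof.
have -> : #|T| - #|A| = #|~: A| by rewrite [RHS]cardsCs setCK.
rewrite -cards_draws -(@card_in_imset _ _ (fun X => X :\: A)).
  apply/subset_leq_card/subsetP => _ /imsetP[X + ->]; rewrite !inE.
  case/andP => sAX /eqP <-.
  by rewrite setDE subsetIr -setDE cardsD (setIidPr sAX) eqxx.
move=> X Y; rewrite !inE => /andP[sAX _] /andP[sAY _] eqXY.
by rewrite -(setID X A) -(setID Y A) (setIidPr sAX) (setIidPr sAY) eqXY.
Qed.

Lemma double_count (T : finType) (F : {set {set T}}) m k :
  (forall X : {set T}, #|X| = m ->
     exists A : {set T}, [/\ A \in F, A \subset X & #|A| = k]) ->
  'C(#|T|, m) <= #|F| * 'C(#|T| - k, m - k).
Proof.
move=> inX; rewrite -card_draws.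
pose up (A : {set T}) := [set X : {set T} | A \subset X & #|X| == m].
apply: (@leq_trans #|\bigcup_(A in F | #|A| == k) up A|).
  apply/subset_leq_card/subsetP => X; rewrite inE => /eqP cX.
  have [A [AF sAX cA]] := inX X cX; apply/bigcupP; exists A; first by rewrite AF cA /=.
  by rewrite inE sAX cX /=.
apply: leq_trans (_ : \sum_(A in F | #|A| == k) #|up A| <= _).
  elim/big_ind2: _ => [|p A q B leA leB|//]; first by rewrite cards0.
  by rewrite (leq_trans (leq_card_setU A B)) // leq_add.
rewrite -sum_nat_const big_mkcondr leq_sum // => A AF.
by case: eqP => // <-; apply: card_supersets.
Qed.

(** The quotient of the two binomials is the product of the (m - i)/(n - i) for i < k, and each
    factor is at most m/n. *)
Lemma bin_ratio n m k : k <= m <= n ->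
  n ^ k * 'C(n - k, m - k) <= m ^ k * 'C(n, m).
Proof.
case/andP => km mn; elim: k km => [|k IHk] km; first by rewrite !subn0.
apply: leq_trans (_ : n ^ k * (m * 'C(n - k, m - k)) <= _); last first.
  by rewrite expnS mulnCA -mulnA leq_mul2l IHk ?orbT // ltnW.
rewrite expnSr -mulnA leq_mul2l; apply/orP; right.
have kn : k < n by apply: leq_trans mn.
have := mul_bin_diag (n - k) (m - k.+1); rewrite -subnS -subSn // subSS => E.
rewrite -(@leq_pmul2l (n - k)) ?subn_gt0 // mulnCA E !mulnA leq_mul2r.
by apply/orP; right; nia.
Qed.

(** The binomial factor shared by [double_count] and [bin_ratio] cancels. *)
Lemma card_lower_bound (T : finType) (F : {set {set T}}) k :
  (forall a, [set a] \in F) -> exchange F -> 'C(k.+1, 2) < #|T| ->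
  #|T| ^ k.+1 <= #|F| * 'C(k.+1, 2).+1 ^ k.+1.
Proof.
move=> F1 exF ltT; set m := 'C(_, _).+1.
have km : k.+1 <= m by rewrite /m binS bin1; lia.
have /double_count cnt : forall X : {set T}, #|X| = m ->
    exists A : {set T}, [/\ A \in F, A \subset X & #|A| = k.+1].
  by move=> X cX; apply: member_of_size; rewrite ?cX.
rewrite -(@leq_pmul2r 'C(#|T| - k.+1, m - k.+1)) ?bin_gt0 ?leq_sub2r //.
have /bin_ratio/leq_trans -> // : k.+1 <= m <= #|T| by rewrite km.
by rewrite mulnAC mulnC leq_mul2r cnt orbT.
Qed.

From mathcomp Require Import all_classical all_reals all_analysis.

Import Order.TTheory GRing.Theory Num.Theory.
Import numFieldNormedType.Exports.

Local Open Scope classical_set_scope.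
Local Open Scope ring_scope.

(** * Rounding the square root of 2n *)

Lemma double_bin2 r : (2 * 'C(r.+1, 2) = r.+1 * r)%N.
Proof. by elim: r => [|r IHr] //; rewrite binS bin1; nia. Qed.

(** Squaring r - 1/2 <= x < r + 1/2 gives r(r - 1) + 1/4 <= 2n < r(r + 1) + 1/4; integrality absorbs
    the quarters. *)
Lemma nearest_sqrt_double (R : archiRcfType) n :
  exists r : nat, [/\ nearest (Num.sqrt (2 * n)%:R : R) = r%:Z,
    (0 < r)%N -> ('C(r, 2) < n)%N & (n <= 'C(r.+1, 2))%N].
Proof.
set x := Num.sqrt _ : R.
have x0 : 0 <= x := sqrtr_ge0 _.
have xx : x * x = 2 * n%:R by rewrite -expr2 sqr_sqrtr ?ler0n // natrM.
have := floor_itv (x + 2^-1); rewrite -/(nearest x) => /andP[].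
have : 0 <= nearest x by rewrite floor_ge0; lra.
case: (nearest x) => // r _; rewrite -[Posz r + 1]/(Posz (r + 1)) -!pmulrn natrD => lex ltx.
exists r; split=> //.
- case: r lex {ltx} => // r lex _; rewrite -(ltn_pmul2l (isT : 0 < 2)%N) double_bin2.
  rewrite -(ltr_nat R) !natrM -xx; move: lex; rewrite -(natr1 r) => lex.
  by have : 0 <= r%:R :> R by []; nra.
- rewrite -(leq_pmul2l (isT : 0 < 2)%N) double_bin2 -ltnS -(ltr_nat R).
  rewrite natrM -xx -(natr1 (_ * _)) natrM -(natr1 r).
  by have : 0 <= r%:R :> R by []; nra.
Qed.

(** * Exponential lower bound on the cardinality *)

Lemma expRN_inv_sqrt2_le (R : realType) :
  expR (- (1 / Num.sqrt 2)) <= Num.sqrt 2 * expR (- 1) :> R.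
Proof.
have s0 : 0 < Num.sqrt 2 :> R by rewrite sqrtr_gt0.
rewrite div1r -ler_pdivrMl //; set y := _^-1.
have -> : - 1 = (y - 1) + - y by ring.
rewrite expRD ler_wpM2r ?expR_ge0 //.
by have := expR_ge1Dx (y - 1); rewrite addrC subrK.
Qed.

Lemma card_ge_expR (R : realType) n (F : {set {set 'I_n}}) :
  atomic F -> weak_exchange F ->
  expR (2 * expR (- (1 / Num.sqrt 2)) * Num.sqrt n%:R - 4) <= #|F|%:R :> R.
Proof.
case/andP => F0 /forallP F1 /weak_exchangeP exF.
have c1 : (1 : R) <= #|F|%:R.
  by rewrite ler1n card_gt0; apply/set0Pn; exists finset.set0.
set t := Num.sqrt n%:R; have t0 : 0 <= t := sqrtr_ge0 _.
(* This is sqrt(2n)/e, the maximizer of (2n/s^2)^s, at which the base equals e^2. *)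
set s := Num.sqrt 2 * expR (- 1) * t.
have s0 : 0 <= s by rewrite !mulr_ge0 ?sqrtr_ge0 ?expR_ge0.
apply: (@le_trans _ _ (expR (2 * s - 4))).
  by rewrite ler_expR lerD2r -mulrA ler_pM2l // ler_wpM2r // expRN_inv_sqrt2_le.
have ss : s ^+ 2 * expR 2 = 2 * n%:R.
  have e2 : expR (- 1) ^+ 2 * expR 2 = 1 :> R.
    by rewrite -expRM_natl -expRD mulrN1 addNr expR0.
  by rewrite -[RHS]mulr1 -[X in _ = _ * X]e2 /s !exprMn !sqr_sqrtr ?ler0n //; ring.
have /andP[] := truncn_itv s0; case: (Num.truncn s) => [|[|k]] ks.
(* The constant 4 makes the claimed bound at most 1 when [s < 2]. For larger [s], rounding down to
   [k.+2] costs at most 2 in the exponent. *)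
1,2: move=> lts; apply: le_trans c1; rewrite expR_le1.
1,2: suff : s < 2 by lra.
1,2: by apply: lt_le_trans lts _; rewrite ler_nat.
rewrite -natr1 => sk.
have k0 : 0 <= k%:R :> R by rewrite ler0n.
set m := 'C(k.+2, 2).+1.
have mk : 2 * m%:R <= k.+2%:R ^+ 2 :> R.
  by rewrite -natrM -natrX ler_nat /m mulnS double_bin2; nia.
have kn : k.+2%:R ^+ 2 * expR 2 <= 2 * n%:R :> R.
  rewrite -ss ler_wpM2r ?expR_ge0 // lerXn2r ?nnegrE ?ler0n //.
have e2 : 1 <= expR 2 :> R by apply: le_trans (expR_ge1Dx 2); lra.
have mn : m%:R * expR 2 <= n%:R :> R.
  rewrite -(@ler_pM2l _ 2) // mulrA; apply: le_trans kn.
  by rewrite ler_wpM2r ?expR_ge0.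
have := card_lower_bound F1 exF; move=> /(_ k.+1); rewrite card_ord -/m.
have -> : ('C(k.+2, 2) < n)%N.
  rewrite -(ler_nat R) -/m; apply: le_trans mn; rewrite ler_peMr ?ler0n //.
move=> /(_ isT); rewrite -(ler_nat R) natrM !natrX => nF.
have mk0 : 0 < m%:R ^+ k.+2 :> R by rewrite exprn_gt0 ?ltr0n.
apply: (@le_trans _ _ (expR 2 ^+ k.+2)).
  by rewrite -expRM_natl ler_expR; move: sk; rewrite -natr1; lra.
rewrite -(ler_pM2r mk0); apply: le_trans nF.
by rewrite -exprMn mulrC lerXn2r ?nnegrE ?ler0n ?mulr_ge0 ?ler0n ?expR_ge0.
Qed.

(** * Numerical comparison with powers of 2 *)

(** Since 16/23 = 128/184, the estimate 1 + x <= e^x at x = 1/184 is raised to the power 8, rounded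
    down to 165/158, then raised to the power 16, which just exceeds 2. *)
Lemma ln2_le (R : realType) : ln 2 <= 16 / 23 :> R.
Proof.
rewrite -[leRHS]expRK ler_ln ?posrE ?expR_gt0 //.
have e1 : 185 / 184 <= expR (1 / 184) :> R.
  by apply: le_trans (expR_ge1Dx _); lra.
have e8 : 165 / 158 <= expR (8%:R * (1 / 184)) :> R.
  rewrite expRM_natl; apply: (@le_trans _ _ ((185 / 184) ^+ 8)); first by lra.
  by rewrite lerXn2r ?nnegrE ?expR_ge0 //; lra.
have -> : 16 / 23 = 16%:R * (8%:R * (1 / 184)) :> R by lra.
rewrite expRM_natl; apply: (@le_trans _ _ ((165 / 158) ^+ 16)); first by lra.
by rewrite lerXn2r ?nnegrE ?expR_ge0 //; lra.
Qed.

(* 1 / sqrt 2 is close to ln 2, so e^(-1/sqrt 2) is well approximated from below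
   by the tangent of e^(-x) at x = ln 2. *)
Lemma ln2_le_expRN_inv_sqrt2 (R : realType) :
  142 / 100 * ln 2 <= 2 * expR (- (1 / Num.sqrt 2)) :> R.
Proof.
have s0 : 0 < Num.sqrt 2 :> R by rewrite sqrtr_gt0.
have ss : Num.sqrt 2 ^+ 2 = 2 :> R by rewrite sqr_sqrtr.
set y := 1 / _.
(* 442/625 = 0.7072 is just above 1/sqrt 2; the tangent bound then only requires 0.42 ln 2 <=
   0.2928, which [ln2_le] provides. *)
have y_le : y <= 442 / 625 by rewrite ler_pdivrMr //; nra.
have -> : - y = - ln 2 + (ln 2 - y) by rewrite addKr.
rewrite expRD expRN lnK ?posrE // mulrA divff ?mul1r ?pnatr_eq0 //.
by have := expR_ge1Dx (ln 2 - y); have := ln2_le R; lra.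
Qed.

Lemma cvg_inv_sqrt (R : realType) :
  (Num.sqrt n%:R)^-1 @[n --> \oo] --> (0 : R).
Proof.
apply/gtr0_cvgV0.
  by near=> n; rewrite sqrtr_gt0 ltr0n; near: n; exact: nbhs_infty_gt.
apply/cvgryPge => A; near=> n.
rewrite (le_trans (ler_norm A)) // -sqrtr_sqr ler_wsqrtr //.
near: n; exact: nbhs_infty_ger.
Unshelve. all: by end_near. Qed.

Theorem theorem1 (R : realType) :
  (* (i) *)
  (exists d d' : nat -> R,
     [/\ d n @[n --> \oo] --> (0 : R),
         d' n @[n --> \oo] --> (0 : R),
         forall (n : nat) (F : {set {set 'I_n}}),
           atomic F -> weak_exchange F ->
           expR ((2 * expR (- (1 / Num.sqrt 2)) + d n) * Num.sqrt n%:R)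
             <= #|F|%:R
       & forall n : nat,
           2 `^ ((142 / 100 + d' n) * Num.sqrt n%:R)
             <= expR ((2 * expR (- (1 / Num.sqrt 2)) + d n) * Num.sqrt n%:R)])
  (* (ii) *)
  /\ (forall (n : nat) (F : {set {set 'I_n}}),
        atomic F -> weak_exchange F ->
        nearest (Num.sqrt (2 * n)%:R : R) <= (rk F)%:Z)
  /\ (forall n : nat, exists F : {set {set 'I_n}},
        [/\ atomic F, weak_exchange F
          & (rk F)%:Z = nearest (Num.sqrt (2 * n)%:R : R)])
  (* the bound on f *)
  /\ (exists d : nat -> R,
        d n @[n --> \oo] --> (0 : R) /\
        forall n : nat,
          2 `^ ((142 / 100 + d n) * Num.sqrt n%:R) <= (f n)%:R).
Proof.
set c := 2 * expR (- (1 / Num.sqrt 2)).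
have cvgd a : a / Num.sqrt n%:R @[n --> \oo] --> (0 : R).
  by rewrite -[X in _ --> X](mulr0 a); apply: cvgMl_tmp; exact: cvg_inv_sqrt.
have cardF (n : nat) (F : {set {set 'I_n}}) : atomic F -> weak_exchange F ->
    expR ((c + - 4 / Num.sqrt n%:R) * Num.sqrt n%:R) <= #|F|%:R.
  (* For n = 0 the division by [Num.sqrt 0] does not cancel: the exponent is 0, and nonemptiness of
     [F] suffices. *)
  move=> atF exF; have [n0|n0] := posnP n.
    have -> : Num.sqrt n%:R = 0 :> R by rewrite n0 sqrtr0.
    case/andP: atF => F0 _; rewrite mulr0 expR0 ler1n card_gt0.
    by apply/set0Pn; exists finset.set0.
  by rewrite mulrDl divfK ?sqrtr_eq0 -?ltNge ?ltr0n // card_ge_expR.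
(* Dividing -4 by [ln 2] makes the error terms agree exactly after the change of base, leaving only
   the comparison of leading constants. *)
have pow_le (n : nat) :
    2 `^ ((142 / 100 + (- 4 / ln 2) / Num.sqrt n%:R) * Num.sqrt n%:R)
      <= expR ((c + - 4 / Num.sqrt n%:R) * Num.sqrt n%:R).
  have ln2 : 0 < ln 2 :> R by rewrite ln_gt0 ?ltr1n.
  rewrite -[X in X `^ _](@lnK R) ?posrE // -expRM ler_expR mulrA.
  rewrite ler_wpM2r ?sqrtr_ge0 // mulrDr [X in _ + X]mulrA [X in _ + X / _]mulrC.
  by rewrite divfK ?gt_eqF // lerD2r mulrC ln2_le_expRN_inv_sqrt2.
split; last split; last split.
- by exists (fun n => - 4 / Num.sqrt n%:R), (fun n => (- 4 / ln 2) / Num.sqrt n%:R).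
- move=> n F atF /weak_exchangeP exF.
  have [r [-> ltn _]] := @nearest_sqrt_double R n.
  rewrite lez_nat; exact: leq_rk.
- move=> n; have [r [-> ltn len]] := @nearest_sqrt_double R n.
  have [|F [F0 F1 exF leF]] := @low_rank_system 'I_n r [set: 'I_n]%SET.
    by rewrite cardsT card_ord.
  have atF : atomic F.
    by rewrite /atomic F0; apply/forallP => a; apply: F1; rewrite finset.inE.
  exists F; split=> //; first exact/weak_exchangeP.
  congr Posz; apply/eqP; rewrite eqn_leq leq_rk // andbT.
  by apply/bigmax_leqP => A /leF[].
- exists (fun n => (- 4 / ln 2) / Num.sqrt n%:R); split=> // n.
  have [[F /and3P[atF _ /strong_weak_exchange exF] <-] _] := fP n.
  exact: le_trans (pow_le n) (cardF n F atF exF).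
Qed.
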